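(* Let $\sigma$ be a relational vocabulary and let $\mathcal{D}$ be a full subcategory of $\mathbf{Struct}(\sigma)$ that is closed under co-retracts and such that $G_k\mathcal{A}\in\mathcal{D}$ for every $\mathcal{A}\in\mathcal{D}$ and every $k>0$. Then the equirank homomorphism preservation theorem holds relative to $\mathcal{D}$: for every positive integer $k$ and every first-order sentence $\varphi$ in the vocabulary $\sigma$ of quantifier rank at most $k$, $\varphi$ is preserved under homomorphisms between structures in $\mathcal{D}$ if and only if there is an existential positive sentence $\psi$ of quantifier rank at most $k$ such that $\mathcal{A}\models\varphi\iff\mathcal{A}\models\psi$ for all $\mathcal{A}\in\mathcal{D}$. In particular, this holds for $\mathcal{D}=\mathrm{Mod}(T)$ whenever $T$ is a set of negative sentences in the vocabulary $\sigma$.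
   Context: $\mathbf{Struct}(\sigma)$ is the category of $\sigma$-structures (relational vocabulary, first-order logic with equality) and homomorphisms. For a $\sigma$-structure $\mathcal{A}$ and $k>0$, $G_k\mathcal{A}$ is the $\sigma$-structure defined as follows: let $E_k(\mathcal{A})$ be the set of nonempty sequences of length at most $k$ of elements of $\mathcal{A}$, ordered by prefix; let $\approx$ be the equivalence relation on $E_k(\mathcal{A})$ generated by identifying two sequences that are comparable in the prefix order and have the same last element; the universe of $G_k\mathcal{A}$ is $E_k(\mathcal{A})/\approx$, and for an $l$-ary $R\in\sigma$, a tuple of classes is in $R^{G_k\mathcal{A}}$ iff it has representatives $s_1,\dots,s_l$ that are pairwise comparable in the prefix order and whose last elements form a tuple in $R^{\mathcal{A}}$. ($G_k$ is a comonad on $\mathbf{Struct}(\sigma)$ whose counit sends the class of a sequence to its last element.) $\mathcal{D}$ is closed under co-retracts if $\mathcal{A}\in\mathcal{D}$ and a section $\mathcal{A}\to\mathcal{B}$ imply $\mathcal{B}\in\mathcal{D}$. An existential positive sentence uses only $\vee,\wedge,\exists$. A negative sentence is built from negated atomic formulas by $\vee,\wedge,\exists,\forall$; $\mathrm{Mod}(T)$ is the class of models of $T$. $\varphi$ is preserved under homomorphisms between structures in $\mathcal{D}$ if for every homomorphism $\mathcal{A}\to\mathcal{B}$ with $\mathcal{A},\mathcal{B}\in\mathcal{D}$, $\mathcal{A}\models\varphi$ implies $\mathcal{B}\models\varphi$.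
   Formalization: The claim for an arbitrary full subcategory D is stated only for finite vocabularies, since it fails over infinite ones (e.g. D: Q is empty iff infinitely many P_n are nonempty); the claim for D = Mod(T) is kept for every relational vocabulary. *)

(* Defs.v *)
From mathcomp Require Import all_boot.
From Stdlib Require Import Relation_Operators FinFun.

Set Implicit Arguments.
Unset Strict Implicit.
Unset Printing Implicit Defensive.

Record vocabulary := Vocabulary { symbol : Type; arity : symbol -> nat }.

(* For an arbitrary class D the equirank theorem fails over infinite
   vocabularies: take unary symbols Q, P_0, P_1, ... and let D consist of the
   structures in which Q is empty exactly when infinitely many P_n are nonempty.
   On D the sentence ~ exists x, Q x is preserved under homomorphisms, but it is
   not equivalent to any (finite) existential positive sentence. *)
Definition finite_vocabulary (sigma : vocabulary) : Prop :=
  Finite (symbol sigma).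

(* Structures may be empty. *)
Record structure (sigma : vocabulary) := Structure {
  carrier :> Type;
  interp : forall R : symbol sigma, ('I_(arity R) -> carrier) -> Prop }.
Arguments interp {sigma} s R _.

Definition hom (sigma : vocabulary) (A B : structure sigma) (f : A -> B) : Prop :=
  forall (R : symbol sigma) (t : 'I_(arity R) -> A),
    interp A R t -> interp B R (fun i => f (t i)).

(* A -> B is a section: it has a left inverse in the category of structures. *)
Definition is_section (sigma : vocabulary) (A B : structure sigma) (s : A -> B) : Prop :=
  hom s /\ exists r : B -> A, hom r /\ cancel s r.

(* A full subcategory of Struct(sigma) is given by its class of objects. *)
Definition co_retract_closed (sigma : vocabulary) (D : structure sigma -> Prop) : Prop :=
  forall (A B : structure sigma) (s : A -> B), is_section s -> D A -> D B.

Section Comonad.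
Variables (sigma : vocabulary) (A : structure sigma) (k : nat).

(* The element of E_k(A) with head x and tail p is the nonempty sequence
   x :: p; its length is (size p).+1 <= k. *)
Record play := Play {
  play_head : A;
  play_tail : seq A;
  play_size : size play_tail < k }.

Definition moves (s : play) : seq A := play_head s :: play_tail s.

Definition last_move (s : play) : A := last (play_head s) (play_tail s).

Definition is_prefix (s t : play) : Prop := exists u, moves t = moves s ++ u.

Definition comparable_plays (s t : play) : Prop := is_prefix s t \/ is_prefix t s.

Definition approx : play -> play -> Prop :=
  clos_refl_sym_trans play
    (fun s t => comparable_plays s t /\ last_move s = last_move t).

(* The quotient of E_k(A) by approx, as the type of equivalence classes. *)
Definition play_class : Type :=
  {C : play -> Prop | exists s, C = approx s}.

Definition class_of_play (s : play) : play_class :=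
  exist _ (approx s) (ex_intro _ s (erefl (approx s))).

Definition G : structure sigma :=
  @Structure sigma play_class (fun R c =>
    exists s : 'I_(arity R) -> play,
      [/\ forall i, class_of_play (s i) = c i,
          forall i j, comparable_plays (s i) (s j)
        & interp A R (fun i => last_move (s i))]).

End Comonad.

(* First-order formulas with equality whose free variables are among n de
   Bruijn indices; a quantifier binds index 0 and shifts the others.  Scoping
   makes satisfaction of sentences meaningful in the empty structure too.
   FTrue and FFalse are the empty conjunction and disjunction, and implication
   is an abbreviation. *)
Inductive formula (sigma : vocabulary) : nat -> Type :=
| FTrue n : formula sigma n
| FFalse n : formula sigma n
| FEq n (i j : 'I_n) : formula sigma n
| FRel n (R : symbol sigma) (v : {ffun 'I_(arity R) -> 'I_n}) : formula sigma n
| FNot n (f : formula sigma n) : formula sigma n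
| FAnd n (f g : formula sigma n) : formula sigma n
| FOr n (f g : formula sigma n) : formula sigma n
| FEx n (f : formula sigma n.+1) : formula sigma n
| FAll n (f : formula sigma n.+1) : formula sigma n.
Arguments FTrue {sigma n}.
Arguments FFalse {sigma n}.
Arguments FEq {sigma n}.
Arguments FRel {sigma n}.

Definition sentence (sigma : vocabulary) : Type := formula sigma 0.

Definition extend (X : Type) (n : nat) (a : X) (e : 'I_n -> X) (i : 'I_n.+1) : X :=
  if unlift ord0 i is Some j then e j else a.

Definition no_vars (X : Type) (i : 'I_0) : X :=
  match notF (ltn_ord i) with end.

Fixpoint holds (sigma : vocabulary) (A : structure sigma) (n : nat)
    (f : formula sigma n) : ('I_n -> A) -> Prop :=
  match f in formula _ m return ('I_m -> A) -> Prop with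
  | FTrue _ => fun _ => True
  | FFalse _ => fun _ => False
  | FEq _ i j => fun e => e i = e j
  | FRel _ R v => fun e => interp A R (fun i => e (v i))
  | FNot _ f => fun e => ~ holds f e
  | FAnd _ f g => fun e => holds f e /\ holds g e
  | FOr _ f g => fun e => holds f e \/ holds g e
  | FEx _ f => fun e => exists a : A, holds f (extend a e)
  | FAll _ f => fun e => forall a : A, holds f (extend a e)
  end.

Definition models (sigma : vocabulary) (A : structure sigma) (phi : sentence sigma) : Prop :=
  holds phi (@no_vars A).

Fixpoint qrank (sigma : vocabulary) (n : nat) (f : formula sigma n) : nat :=
  match f with
  | FTrue _ | FFalse _ | FEq _ _ _ | FRel _ _ _ => 0
  | FNot _ f => qrank f
  | FAnd _ f g | FOr _ f g => maxn (qrank f) (qrank g)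
  | FEx _ f | FAll _ f => (qrank f).+1
  end.

Fixpoint existential_positive (sigma : vocabulary) (n : nat) (f : formula sigma n) : bool :=
  match f with
  | FTrue _ | FFalse _ | FEq _ _ _ | FRel _ _ _ => true
  | FAnd _ f g | FOr _ f g => existential_positive f && existential_positive g
  | FEx _ f => existential_positive f
  | FNot _ _ | FAll _ _ => false
  end.

Definition atomic (sigma : vocabulary) (n : nat) (f : formula sigma n) : bool :=
  match f with FEq _ _ _ | FRel _ _ _ => true | _ => false end.

Fixpoint negative (sigma : vocabulary) (n : nat) (f : formula sigma n) : bool :=
  match f with
  | FTrue _ | FFalse _ => true
  | FEq _ _ _ | FRel _ _ _ => false
  | FNot _ f => atomic f
  | FAnd _ f g | FOr _ f g => negative f && negative g
  | FEx _ f | FAll _ f => negative f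
  end.

Definition Mod (sigma : vocabulary) (T : sentence sigma -> Prop) (A : structure sigma) : Prop :=
  forall phi, T phi -> models A phi.

Definition hom_preserved (sigma : vocabulary) (D : structure sigma -> Prop)
    (phi : sentence sigma) : Prop :=
  forall (A B : structure sigma) (f : A -> B),
    D A -> D B -> hom f -> models A phi -> models B phi.

Definition equirank_HPT (sigma : vocabulary) (D : structure sigma -> Prop) : Prop :=
  forall (k : nat) (phi : sentence sigma), 0 < k -> qrank phi <= k ->
    (hom_preserved D phi <->
     exists psi : sentence sigma,
       [/\ existential_positive psi, qrank psi <= k
         & forall A : structure sigma, D A -> (models A phi <-> models A psi)]).

(* Main.v *)
(* The proof follows Rossman's equirank argument.  Suppose that A and B lie in D,
   that A satisfies phi, and that B satisfies the rank-k existential positive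
   theory of A; equivalently, Duplicator wins the k-round existential game from A
   to B, so there is a homomorphism from C = G_k A to B.  Duplicator wins this
   game between A and C in both directions.  Gluing to A the unravellings of C
   over all positions that are existentially equivalent, symmetrically for C, and
   iterating omega times gives A' and C' which retract onto A and C and satisfy
   the same sentences of rank k.  Then phi is transported along
   A -> A' == C' -> C -> B.  Over finitely many symbols the game is decided by
   finitely many formulas, which yields psi.  For Mod(T), the symbols not in phi
   can be interpreted as empty relations, since negative sentences are pulled
   back along surjective homomorphisms. *)

Require Import Defs.
From mathcomp Require Import all_boot.
From Stdlib Require Import Relation_Operators.
From Stdlib Require Import ClassicalEpsilon FunctionalExtensionality.
From Stdlib Require Import PropExtensionality ProofIrrelevance.
From Stdlib Require List.

Set Implicit Arguments.
Unset Strict Implicit.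
Unset Printing Implicit Defensive.

Lemma fun_choice (X Y : Type) (C : X -> Y -> Prop) :
  (forall x, exists y, C x y) -> exists f : X -> Y, forall x, C x (f x).
Proof.
move=> CP; exists (fun x => proj1_sig (constructive_indefinite_description _ (CP x))).
by move=> x; case: constructive_indefinite_description.
Qed.

(** * Partial homomorphisms and the existential game *)

Section Games.
Variable sigma : vocabulary.

(** Domains are predicates on one ambient type, so the stages of an increasing chain are literally
    nested and their union needs no transport. *)
Record prestructure (T : Type) := Prestructure {
  dom : T -> Prop;
  rel : forall R : symbol sigma, ('I_(arity R) -> T) -> Prop }.
Arguments rel {T} p R _.

Definition well_formed T (P : prestructure T) : Prop :=
  forall R (t : 'I_(arity R) -> T), rel P R t -> forall i, dom P (t i).

Definition prestructure_of (A : structure sigma) : prestructure A :=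
  Prestructure (fun _ => True) (interp A).

Definition structure_of T (P : prestructure T) : structure sigma :=
  @Structure sigma {x : T | dom P x} (fun R t => rel P R (fun i => sval (t i))).

Definition add T T' (a : T) (b : T') (p : T -> T' -> Prop) : T -> T' -> Prop :=
  fun x y => (x = a /\ y = b) \/ p x y.

Definition flip_rel T T' (p : T -> T' -> Prop) : T' -> T -> Prop := fun y x => p x y.

Definition nowhere T T' : T -> T' -> Prop := fun _ _ => False.

Definition functional T T' (p : T -> T' -> Prop) : Prop :=
  forall x y y', p x y -> p x y' -> y = y'.

Definition preserving T T' (P : prestructure T) (Q : prestructure T')
    (p : T -> T' -> Prop) : Prop :=
  forall R (t : 'I_(arity R) -> T) t', (forall i, p (t i) (t' i)) ->
    rel P R t -> rel Q R t'.

(* Duplicator wins the [r]-round existential game from [P] to [Q], starting from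
   the pairs in [p]. *)
Fixpoint sim T T' (P : prestructure T) (Q : prestructure T') (r : nat)
    (p : T -> T' -> Prop) : Prop :=
  [/\ functional p, preserving P Q p &
    if r is r'.+1 then
      forall a, dom P a -> exists b, dom Q b /\ sim P Q r' (add a b p)
    else True].

(** A homomorphism given by its graph: no value is demanded outside the domain of [P], which matters
    when the target type is empty. *)
Definition phom T T' (P : prestructure T) (Q : prestructure T')
    (H : T -> T' -> Prop) : Prop :=
  [/\ forall x, dom P x -> exists y, dom Q y /\ H x y, functional H
    & preserving P Q H].

Definition graph T T' (f : T -> T') : T -> T' -> Prop := fun x y => y = f x.

Lemma add_sub T T' (a : T) (b : T') p q :
  (forall x y, p x y -> q x y) -> forall x y, add a b p x y -> add a b q x y.
Proof. by move=> pq x y [xy|/pq]; [left|right]. Qed.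

Lemma sim_functional T T' (P : prestructure T) (Q : prestructure T') r p :
  sim P Q r p -> functional p.
Proof. by case: r => [|r] []. Qed.

Lemma sim_preserving T T' (P : prestructure T) (Q : prestructure T') r p :
  sim P Q r p -> preserving P Q p.
Proof. by case: r => [|r] []. Qed.

Lemma sim_sub T T' (P : prestructure T) (Q : prestructure T') r p q :
  (forall x y, p x y -> q x y) -> sim P Q r q -> sim P Q r p.
Proof.
elim: r p q => [|r IH] p q pq [fq hq sq]; split=> //.
- by move=> x y y' /pq xy /pq; apply: fq.
- by move=> R t t' tt'; apply: hq => i; apply: pq.
- by move=> x y y' /pq xy /pq; apply: fq.
- by move=> R t t' tt'; apply: hq => i; apply: pq.
move=> a /sq[b [Qb sb]]; exists b; split=> //; apply: IH sb; exact: add_sub.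
Qed.

Lemma sim_pred T T' (P : prestructure T) (Q : prestructure T') r p :
  sim P Q r.+1 p -> sim P Q r p.
Proof.
elim: r p => [|r IH] p [fp hp sp]; split=> //.
by move=> a /sp[b [Qb sb]]; exists b; split=> //; apply: IH.
Qed.

(** Duplicator sends Spoiler's move through [f], answers it in the game from [P] to [Q], and sends
    the answer on through [g]. The invariant is that every pair of [p'] factors through [p]. *)
Lemma sim_map T1 T2 T3 T4 (P' : prestructure T1) (P : prestructure T2)
    (Q : prestructure T3) (Q' : prestructure T4) f g r p p' :
  phom P' P f -> phom Q Q' g ->
  (forall x y, p' x y -> exists u v, [/\ f x u, p u v & g v y]) ->
  sim P Q r p -> sim P' Q' r p'.
Proof.
move=> [totf fnf hf] [totg fng hg].
have atoms q q' : (forall x y, q' x y -> exists u v, [/\ f x u, q u v & g v y]) ->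
    functional q -> preserving P Q q -> functional q' /\ preserving P' Q' q'.
  move=> qq' fq hq; split.
    move=> x y y' /qq'[u [v [fu uv gv]]] /qq'[u' [v' [fu' uv' gv']]].
    rewrite -(fnf _ _ _ fu fu') in uv'.
    by rewrite -(fq _ _ _ uv uv') in gv'; apply: fng gv gv'.
  move=> R t t' tt' Pt.
  have /fun_choice[u uP] i := qq' _ _ (tt' i).
  have /fun_choice[v vP] := uP.
  apply: (hg R v); first by move=> i; case: (vP i).
  apply: (hq R u); first by move=> i; case: (vP i).
  by apply: (hf R t) => // i; case: (vP i).
elim: r p p' => [|r IH] p p' pp' [fp hp sp]; have [? ?] := atoms _ _ pp' fp hp; split=> //.
move=> a /totf[u [Pu fau]]; have [v [Qv sv]] := sp _ Pu.
have [b [Q'b gvb]] := totg _ Qv; exists b; split=> //.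
apply: IH sv => x y [[-> ->]|/pp'[u' [v' [fu' uv' gv']]]].
  by exists u, v; split=> //; left.
by exists u', v'; split=> //; right.
Qed.

Lemma phom_graph T T' (P : prestructure T) (Q : prestructure T') (f : T -> T') :
  (forall x, dom P x -> dom Q (f x)) ->
  (forall R (t : 'I_(arity R) -> T), rel P R t -> rel Q R (fun i => f (t i))) ->
  phom P Q (graph f).
Proof.
move=> df rf; split=> [x Px|x y y' -> -> //|R t t' tt' Pt].
  by exists (f x); split=> //; apply: df.
by have -> : t' = (fun i => f (t i)); [apply: functional_extensionality | apply: rf].
Qed.

Lemma phom_id T (P : prestructure T) : phom P P (graph id).
Proof. exact: phom_graph. Qed.

Lemma sim_hom T T' (P : prestructure T) (Q : prestructure T') f r p :
  phom P Q f -> (forall x y, p x y -> f x y) -> sim P Q r p.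
Proof.
move=> hf; elim: r p => [|r IH] p pf; (have [totf fnf pf'] := hf); split=> //.
- by move=> x y y' /pf xy /pf; apply: fnf.
- by move=> R t t' tt'; apply: pf' => i; apply: pf.
- by move=> x y y' /pf xy /pf; apply: fnf.
- by move=> R t t' tt'; apply: pf' => i; apply: pf.
move=> a /totf[b [Qb ab]]; exists b; split=> //; apply: IH => x y [[-> ->]|/pf] //.
Qed.

Definition all_dom T (P : prestructure T) (s : seq T) : Prop :=
  forall x, List.In x s -> dom P x.

(* Histories list the most recent move first. *)
Fixpoint play_out T T' (g : seq T -> T') (p : T -> T' -> Prop) (s : seq T) :
    T -> T' -> Prop :=
  if s is x :: s' then add x (g s) (play_out g p s') else p.

(** The alternating quantifiers of [sim] become one function of histories: [epsilon] picks each
    answer relative to the position [hist] built from the earlier ones. The empty history gets the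
    default [d], which need not lie in the domain. *)
Lemma strategy T T' (P : prestructure T) (Q : prestructure T') (d : T') r p :
  sim P Q r p ->
  exists g : seq T -> T', forall s, size s <= r -> all_dom P s ->
    sim P Q (r - size s) (play_out g p s) /\ (s <> [::] -> dom Q (g s)).
Proof.
move=> sp.
pose good (s : seq T) x q y := dom Q y /\ sim P Q (r - (size s).+1) (add x y q).
pose hist := fix hist (s : seq T) : T -> T' -> Prop := if s is x :: s' then
  add x (epsilon (inhabits d) (good s' x (hist s'))) (hist s') else p.
pose g (s : seq T) := if s is x :: s' then
  epsilon (inhabits d) (good s' x (hist s')) else d.
have gE s : play_out g p s = hist s by elim: s => //= x s ->.
exists g; elim=> [|x s IH] //= szs Ps; first by rewrite subn0.
have [|s1 _] := IH (ltnW szs); first by move=> y sy; apply: Ps; right.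
have : exists y, good s x (hist s) y.
  rewrite gE -[r - size s]prednK ?subn_gt0 // in s1.
  rewrite /good subnS; case: s1 => _ _; apply; apply: Ps; by left.
by move/(epsilon_spec (inhabits d)) => -[Qy sy]; rewrite gE.
Qed.

Lemma play_out_cat T T' (g : seq T -> T') p s1 s2 x y :
  play_out g p s2 x y -> play_out g p (s1 ++ s2) x y.
Proof. by elim: s1 => //= z s1 IH /IH; right. Qed.

End Games.
Arguments rel {sigma T} p R _.

(** * Back-and-forth systems and quantifier rank *)

Section BackAndForth.
Variables (sigma : vocabulary) (A B : structure sigma).
Variable Z : nat -> (A -> B -> Prop) -> Prop.
Hypothesis Zatom : forall r p, Z r p ->
  [/\ functional p, functional (flip_rel p),
      preserving (prestructure_of A) (prestructure_of B) p
    & preserving (prestructure_of B) (prestructure_of A) (flip_rel p)].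
Hypothesis Zforth : forall r p, Z r.+1 p -> forall a, exists b, Z r (add a b p).
Hypothesis Zback : forall r p, Z r.+1 p -> forall b, exists a, Z r (add a b p).

Lemma extend_add n (p : A -> B -> Prop) a b (e : 'I_n -> A) (e' : 'I_n -> B) :
  (forall i, p (e i) (e' i)) -> forall i, add a b p (extend a e i) (extend b e' i).
Proof. by move=> ee' i; rewrite /extend; case: unlift => [j|]; [right|left]. Qed.

(** The Ehrenfeucht-Fraisse argument: each quantifier spends one round. The position [p] may hold
    more pairs than the two assignments use. *)
Lemma back_and_forth n (f : formula sigma n) r p e e' :
  qrank f <= r -> Z r p -> (forall i, p (e i) (e' i)) -> holds f e <-> holds f e'.
Proof.
elim: f r p e e' => {n} [n|n|n i j|n R v|n f IH|n f IHf g IHg|n f IHf g IHg|n f IH|n f IH]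
  r p e e' /=.
- by [].
- by [].
- move=> _ /Zatom[fp fp' _ _] ee'; split=> E.
    by apply: (fp (e i)) => //; rewrite E.
  by apply: (fp' (e' i)); rewrite /flip_rel // E.
- move=> _ /Zatom[_ _ h h'] ee'; split.
    by apply: h => i.
  by apply: h' => i; apply: ee'.
- by move=> fr Zp ee'; rewrite (IH _ _ _ _ fr Zp ee').
- rewrite geq_max => /andP[fr gr] Zp ee'.
  by rewrite (IHf _ _ _ _ fr Zp ee') (IHg _ _ _ _ gr Zp ee').
- rewrite geq_max => /andP[fr gr] Zp ee'.
  by rewrite (IHf _ _ _ _ fr Zp ee') (IHg _ _ _ _ gr Zp ee').
- case: r => // r fr Zp ee'; split=> -[c hc].
    have [b Zb] := Zforth Zp c; exists b.
    by apply/(IH _ _ _ _ fr Zb (extend_add c b ee')).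
  have [a Za] := Zback Zp c; exists a.
  by apply/(IH _ _ _ _ fr Za (extend_add a c ee')).
case: r => // r fr Zp ee'; split=> hc c.
  have [a Za] := Zback Zp c.
  by apply/(IH _ _ _ _ fr Za (extend_add a c ee')).
have [b Zb] := Zforth Zp c.
by apply/(IH _ _ _ _ fr Zb (extend_add c b ee')).
Qed.

End BackAndForth.

(** * Gluing unravellings *)

(* [New m r w s] is the point, added at stage [m], reached by the moves [s]
   (most recent first) in the depth-[r] unravelling over the position [w]. *)
Inductive point (X : Type) :=
| Base (x : X)
| New (m r : nat) (w : seq (point X * point X)) (s : seq (point X)).

Section Attach.
Variables (sigma : vocabulary) (X : Type) (m : nat).
Notation U := (point X).
Variables P Q : prestructure sigma U.

Definition pairs (w : seq (U * U)) : U -> U -> Prop := fun u x => List.In (u, x) w.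

Definition admissible (r : nat) (w : seq (U * U)) : Prop :=
  [/\ forall u x, pairs w u x -> dom P u /\ dom Q x, sim P Q r (pairs w)
    & sim Q P r (flip_rel (pairs w))].

Definition admissible_play r w s : Prop :=
  [/\ admissible r w, size s <= r & all_dom Q s].

(** Matches the nodes passed by the play [s] with the elements of [Q] that they copy. At the root
    the points of [w] stand for themselves, which is what glues the copy to [P]. *)
Fixpoint branch r w s : U -> U -> Prop :=
  if s is y :: s' then add (New m r w s) y (branch r w s') else pairs w.

(* Along every equivalent position [w] of [P] and [Q], glue to [P] the tree of
   plays of [Q] starting from [w]. *)
Definition attach : prestructure sigma U := Prestructure
  (fun u => dom P u \/ exists r w y s,
    u = New m r w (y :: s) /\ admissible_play r w (y :: s))
  (fun R t => rel P R t \/ exists r w s x,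
    [/\ admissible_play r w s, forall j, branch r w s (t j) (x j) & rel Q R x]).

Hypothesis fresh : forall r w s, ~ dom P (New m r w s).
Hypothesis wfP : well_formed P.
Hypothesis wfQ : well_formed Q.

Lemma all_dom_cons y s : all_dom Q (y :: s) <-> dom Q y /\ all_dom Q s.
Proof.
split=> [H|[Hy Hs] z [<-|/Hs]] //.
by split=> [|z zs]; apply: H; [left|right].
Qed.

Lemma branchP r w s u x : branch r w s u x ->
  pairs w u x \/ exists s', u = New m r w (x :: s').
Proof.
elim: s => /= [|y s IH]; first by left.
by case=> [[-> ->]|/IH //]; right; exists s.
Qed.

Lemma branch_dom r w s u x : admissible_play r w s -> branch r w s u x -> dom attach u.
Proof.
case=> aw; elim: s => /= [|y s IH] szs Qs; first by move=> /(let: And3 d _ _ := aw in d)[]; left.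
move/all_dom_cons: (Qs) => [Qy Qs']; case=> [[-> _]|]; last exact: IH (ltnW szs) Qs'.
by right; exists r, w, y, s.
Qed.

Lemma attach_wf : well_formed attach.
Proof.
move=> R t [/wfP Pt j|[r [w [s [x [ps ts _]]]]] j]; first by left.
exact: branch_dom ps (ts j).
Qed.

Lemma attach_incl : phom P attach (graph id).
Proof. by apply: phom_graph => [x|R t]; left. Qed.

(** On each copy the retraction follows Duplicator's winning strategy from [Q] to [P] over [w]. Each
    new tuple lies on one branch, hence in the position after a single play, where relations are
    preserved. *)
Lemma attach_retract : exists rho : U -> U,
  [/\ forall u, dom P u -> rho u = u, forall u, dom attach u -> dom P (rho u)
    & forall R (t : 'I_(arity R) -> U), rel attach R t -> rel P R (fun i => rho (t i))].
Proof.
have /fun_choice[g gP] : forall rw : nat * seq (U * U), exists g : seq U -> U,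
    admissible rw.1 rw.2 -> forall s, size s <= rw.1 -> all_dom Q s ->
    sim Q P (rw.1 - size s) (play_out g (flip_rel (pairs rw.2)) s) /\
    (s <> [::] -> dom P (g s)).
  case=> r w /=; case: (classic (admissible r w)) => [aw|naw].
    by have [g gP] := strategy (New 0 0 [::] [::]) (let: And3 _ _ h := aw in h); exists g.
  by exists (fun _ => New 0 0 [::] [::]).
(* Only labels of stage [m] are moved; by [fresh] no point of [P] carries one. *)
pose rho (u : U) :=
  if u is New m' r w s then if m' == m then g (r, w) s else u else u.
have rhoP u : dom P u -> rho u = u.
  case: u => //= m' r w s; case: eqP => // -> /fresh [].
have rho_branch r w s u x : admissible r w -> branch r w s u x ->
    play_out (g (r, w)) (flip_rel (pairs w)) s x (rho u).
  move=> aw; elim: s => /= [uw|y s IH].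
    by rewrite rhoP //; case: aw => /(_ _ _ uw)[].
  by case=> [[-> ->]|/IH]; [left; rewrite /= eqxx | right].
exists rho; split=> //.
  move=> u [Pu|[r [w [y [s [-> [aw szs Qs]]]]]]]; first by rewrite rhoP.
  by rewrite /= eqxx; have [_] := gP (r, w) aw _ szs Qs; apply.
move=> R t [Pt|[r [w [s [x [[aw szs Qs] tx Qx]]]]]].
  have -> // : (fun i => rho (t i)) = t.
  by apply: functional_extensionality => i; rewrite rhoP //; apply: wfP Pt i.
have [sg _] := gP (r, w) aw _ szs Qs.
by apply: (sim_preserving sg) Qx => j; apply: rho_branch.
Qed.

(** Duplicator answers with the node reached by extending the play. Relations along a branch hold in
    [attach] by construction, and the size bound leaves room for [r] further moves. *)
Lemma sim_branch r R w s : admissible_play R w s ->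
  functional (flip_rel (branch R w s)) -> size s + r <= R ->
  sim Q attach r (flip_rel (branch R w s)).
Proof.
elim: r s => [|r IH] s ps fs szs; (have hs : preserving Q attach (flip_rel (branch R w s))
    by move=> S x t xt Qx; right; exists R, w, s, x); split=> // y Qy.
(* A second node for a repeated move would make the flipped branch multivalued, so the earlier point
   is reused. *)
case: (classic (exists u, branch R w s u y)) => [[u uy]|ny].
  exists u; split; first exact: branch_dom ps uy.
  apply: (@sim_sub _ _ _ _ _ _ _ (flip_rel (branch R w s))).
    by move=> x v [[-> ->]|].
  by apply: IH => //; rewrite (leq_trans _ szs) // addnS.
have [aw _ Qs] := ps.
have ps' : admissible_play R w (y :: s).
  split=> //=; last exact/all_dom_cons.
  by rewrite (leq_trans _ szs) // addnS ltnS leq_addr.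
have top : branch R w (y :: s) (New m R w (y :: s)) y by left.
exists (New m R w (y :: s)); split; first exact: branch_dom ps' top.
apply: (@sim_sub _ _ _ _ _ _ _ (flip_rel (branch R w (y :: s)))).
  by move=> x v [[-> ->]|xv]; [left|right].
apply: IH => //; last by rewrite /= addSnnS.
move=> x v v' [[-> ->]|xv] [[-> ?]|xv'] //.
- by case: ny; exists v'.
- by case: ny; exists v; subst.
exact: fs xv xv'.
Qed.

(* Points of the copy over [w] are sent to their last moves; points of the
   copies over other positions are first retracted to [P]. *)
Lemma sim_glue R w rho r l lP :
  (forall u, dom P u -> rho u = u) -> (forall u, dom attach u -> dom P (rho u)) ->
  (forall S (t : 'I_(arity S) -> U), rel attach S t -> rel P S (fun i => rho (t i))) ->
  admissible R w -> sim P Q r lP -> (forall u x, pairs w u x -> lP u x) ->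
  (forall u z, l u z -> (exists s, u = New m R w (z :: s)) \/
     (forall s, u <> New m R w s) /\ lP (rho u) z) ->
  sim attach Q r l.
Proof.
move=> rhoP rho_dom rho_rel aw.
have atoms l' lP' : functional lP' -> preserving P Q lP' ->
    (forall u x, pairs w u x -> lP' u x) ->
    (forall u z, l' u z -> (exists s, u = New m R w (z :: s)) \/
       (forall s, u <> New m R w s) /\ lP' (rho u) z) ->
    functional l' /\ preserving attach Q l'.
  move=> fP hP wP ll; split.
    move=> u z z' /ll[[s us]|[nu uz]] /ll[[s' us']|[nu' uz']].
    - by move: us'; rewrite us => -[].
    - by case: (nu' _ us).
    - by case: (nu _ us').
    exact: fP uz uz'.
  move=> S t z tz At.
  have viaP : (forall j s, t j <> New m R w s) -> rel Q S z.
    move=> nt; apply: hP (rho_rel _ _ At) => j.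
    by case: (ll _ _ (tz j)) => [[s /nt]|[]].
  case: At => [Pt|[r2 [w2 [s [x [[aw2 _ _] tx Qx]]]]]].
    by apply: viaP => j s ts; apply: (@fresh R w s); rewrite -ts; apply: wfP Pt j.
  (* A new tuple lies in one copy. Over [w] itself, last moves recover the related tuple [x] of [Q];
     over any other position the tuple misses the copy over [w] and is retracted to [P]. *)
  case: (classic (r2 = R /\ w2 = w)) => [[er ew]|ne].
    subst; have -> // : z = x; apply: functional_extensionality => j.
    case: (branchP (tx j)) => [tw|[s' ts']]; case: (ll _ _ (tz j)) => [[s2 ts2]|[nt tP]].
    - by case: (@fresh R w (z j :: s2)); rewrite -ts2; case: aw => /(_ _ _ tw)[].
    - apply: fP tP _; rewrite rhoP; first exact: wP.
      by case: aw => /(_ _ _ tw)[].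
    - by move: ts2; rewrite ts' => -[].
    by case: (nt _ ts').
  apply: viaP => j s2 ts2; case: (branchP (tx j)) => [tw|[s' ts']].
    by apply: (@fresh R w s2); rewrite -ts2; case: aw2 => /(_ _ _ tw)[].
  by move: ts'; rewrite ts2 => -[] eR ew _; case: ne.
elim: r l lP => [|r IH] l lP [fP hP sP] wP ll; have [? ?] := atoms _ _ fP hP wP ll; split=> // u Au.
(* A point of the copy over [w] is answered by its last move, without consulting the game from [P]
   to [Q]; [lP] stays as it is and merely loses a round. *)
case: (classic (exists z s, u = New m R w (z :: s) /\ dom Q z)) => [[z [s [us Qz]]]|nu].
  exists z; split=> //; apply: (IH _ lP) => //.
    by apply: sim_pred.
  by move=> v y [[-> ->]|/ll //]; left; exists s.
have [z [Qz sz]] := sP _ (rho_dom _ Au).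
exists z; split=> //; apply: IH sz _ _; first by move=> v x /wP; right.
move=> v y [[-> ->]|/ll[|[nv vy]]]; [right|by left|by right; split=> //; right].
split; last by left.
move=> s us; subst; case: Au => [/fresh //|[r' [w' [y' [s' [[er ew es] [_ _ Qs]]]]]]].
subst; case: nu; exists y', s'; split=> //.
by case/all_dom_cons: Qs.
Qed.

(** The node for the one-move play [y] over [w] is the answer. Towards [Q] it goes to its last move
    [y], by [sim_glue]; from [Q], play continues up its branch, by [sim_branch]. *)
Lemma attach_answer r w y : admissible r.+1 w -> dom Q y ->
  exists c, [/\ dom attach c, sim attach Q r (pairs ((c, y) :: w))
    & sim Q attach r (flip_rel (pairs ((c, y) :: w)))].
Proof.
move=> aw Qy; have [rho [rhoP rho_dom rho_rel]] := attach_retract.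
have [wd sPQ sQP] := aw.
have retr : phom attach P (graph rho) by apply: phom_graph.
(* If [y] already has a partner in [w], functionality forces that partner. *)
case: (classic (exists b, pairs w b y)) => [[b wb]|ny].
  have sub u x : pairs ((b, y) :: w) u x -> pairs w u x by case=> [[<- <-]|].
  exists b; split; first by left; case: (wd _ _ wb).
    apply: (sim_map retr (phom_id Q)) (sim_pred sPQ) => u x /sub wu.
    by exists u, x; split=> //; rewrite /graph rhoP //; case: (wd _ _ wu).
  apply: (sim_map (phom_id Q) attach_incl) (sim_pred sQP) => x u /sub wu.
  by exists x, u.
have py : admissible_play r.+1 w [:: y] by split=> // z [<-|].
exists (New m r.+1 w [:: y]); split.
- by right; exists r.+1, w, y, [::].
- apply: (sim_glue rhoP rho_dom rho_rel aw (sim_pred sPQ)) => // u z.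
  case=> [[<- <-]|wu]; first by left; exists [::].
  have [Pu _] := wd _ _ wu; right; rewrite rhoP //; split=> // s us.
  by apply: (@fresh r.+1 w s); rewrite -us.
apply: (@sim_sub _ _ _ _ _ _ _ (flip_rel (branch r.+1 w [:: y]))).
  by move=> x u [[<- <-]|]; [left|right].
apply: sim_branch => // x u u' [[-> e]|xu] [[-> e']|xu'] //.
- by subst; case: ny; exists u'.
- by subst; case: ny; exists u.
exact: sim_functional sQP _ _ _ xu xu'.
Qed.

End Attach.

(** * Rank-k equivalent co-retracts *)

Section Companions.
Variables (sigma : vocabulary) (X : Type).
(** Indexing by Booleans lets one argument serve both sides, and embedding both carriers in [X] puts
    the two chains in the same type of points. *)
Variable A : bool -> structure sigma.
Variable emb : forall i, A i -> X.
Hypothesis emb_inj : forall i, injective (@emb i).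
Notation U := (point X).

Definition base (i : bool) : prestructure sigma U := Prestructure
  (fun u => exists a, u = Base (@emb i a))
  (fun R t => exists a, interp (A i) R a /\ t = fun j => Base (emb (a j))).

Fixpoint stage (n : nat) (i : bool) : prestructure sigma U :=
  if n is n'.+1 then attach n' (stage n' i) (stage n' (~~ i)) else base i.

Definition limit (i : bool) : prestructure sigma U := Prestructure
  (fun u => exists n, dom (stage n i) u) (fun R t => exists n, rel (stage n i) R t).

Lemma stage_wf n i : well_formed (stage n i).
Proof.
elim: n i => [|n IH] i /=; last exact: attach_wf.
by move=> R t [a [_ ->]] j; exists (a j).
Qed.

Lemma stage_new n i m r w s : dom (stage n i) (New m r w s) -> m < n.
Proof.
elim: n i => [|n IH] i /=; first by case.
by case=> [/IH/ltnW //|[r' [w' [y' [s' [[-> _ _ _] _]]]]]].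
Qed.

Lemma stage_fresh n i r w s : ~ dom (stage n i) (New n r w s).
Proof. by move/stage_new; rewrite ltnn. Qed.

Lemma stage_dom_le n n' i u : n <= n' -> dom (stage n i) u -> dom (stage n' i) u.
Proof.
move/subnKC <-; elim: (n' - n) => [|d IH]; first by rewrite addn0.
by rewrite addnS => /IH; left.
Qed.

Lemma stage_rel_le n n' i R t : n <= n' -> rel (stage n i) R t -> rel (stage n' i) R t.
Proof.
move/subnKC <-; elim: (n' - n) => [|d IH]; first by rewrite addn0.
by rewrite addnS => /IH; left.
Qed.

Lemma stage_retractions i : exists rho : nat -> U -> U, forall n,
  [/\ forall u, dom (stage n i) u -> rho n u = u,
      forall u, dom (stage n.+1 i) u -> dom (stage n i) (rho n u)
    & forall R t, rel (stage n.+1 i) R t -> rel (stage n i) R (fun j => rho n (t j))].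
Proof.
apply: (fun_choice (C := fun n f =>
  [/\ forall u, dom (stage n i) u -> f u = u,
      forall u, dom (stage n.+1 i) u -> dom (stage n i) (f u)
    & forall R t, rel (stage n.+1 i) R t -> rel (stage n i) R (fun j => f (t j))])) => n.
exact: attach_retract (@stage_fresh n i) (@stage_wf n i).
Qed.

(** The retractions between consecutive stages are composed downwards from any stage containing the
    point. Later retractions fix earlier stages, so the result does not depend on the starting
    stage. *)
Lemma limit_retract m i : exists rho : U -> U,
  phom (limit i) (stage m i) (graph rho) /\ forall u, dom (stage m i) u -> rho u = u.
Proof.
have [rho rhoP] := stage_retractions i.
pose down := fix down d u := if d is d'.+1 then down d' (rho (m + d') u) else u.
have down_dom d u : dom (stage (m + d) i) u -> dom (stage m i) (down d u).
  elim: d u => [|d IH] u /=; first by rewrite addn0.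
  by rewrite addnS; case: (rhoP (m + d)) => _ h _ /h/IH.
have down_rel d R t : rel (stage (m + d) i) R t ->
    rel (stage m i) R (fun j => down d (t j)).
  elim: d t => [|d IH] t /=; first by rewrite addn0.
  by rewrite addnS; case: (rhoP (m + d)) => _ _ h /h/IH.
have down_stable d e u : dom (stage (m + d) i) u -> down (d + e) u = down d u.
  move=> du; elim: e => [|e IH]; first by rewrite addn0.
  have [h _ _] := rhoP (m + (d + e)); rewrite addnS /= h //.
  by apply: stage_dom_le du; rewrite addnA leq_addr.
pose depth u := epsilon (inhabits 0) (fun d => dom (stage (m + d) i) u).
have depthE d u : dom (stage (m + d) i) u -> down (depth u) u = down d u.
  move=> du; have : dom (stage (m + depth u) i) u.
    exact: (epsilon_spec (inhabits 0) _ (ex_intro (fun d => dom (stage (m + d) i) u) d du)).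
  by move/(down_stable _ d) => <-; rewrite addnC; apply: down_stable.
have shift n u : dom (stage n i) u -> dom (stage (m + n) i) u.
  by apply: stage_dom_le; rewrite leq_addl.
exists (fun u => down (depth u) u); split.
  apply: phom_graph => [u [n /shift du]|R t [n tn]].
    by rewrite (depthE _ _ du); apply: down_dom.
  (* The depths of the points of a tuple are chosen independently; they are replaced by one depth
     [n], that of the tuple. *)
  have Et : (fun j => down (depth (t j)) (t j)) = (fun j => down n (t j)).
    by apply: functional_extensionality => j; apply: depthE; apply: shift; exact: stage_wf tn j.
  by rewrite Et; apply: down_rel; apply: stage_rel_le tn; rewrite leq_addl.
by move=> u du; rewrite (depthE 0) // addn0.
Qed.

Lemma stage_limit n i : phom (stage n i) (limit i) (graph id).
Proof. by apply: phom_graph => [u|R t]; exists n. Qed.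

Lemma base_to_limit i :
  phom (prestructure_of (A i)) (limit i) (graph (fun a => Base (emb a))).
Proof.
apply: phom_graph => [a _|R a Aa]; first by exists 0, a.
by exists 0, a.
Qed.

Lemma limit_to_base i : exists f : U -> A i -> Prop,
  phom (limit i) (prestructure_of (A i)) f /\ forall a, f (Base (emb a)) a.
Proof.
have [rho [[rd _ rr] rhoP]] := limit_retract 0 i.
exists (fun u a => rho u = Base (emb a)); split; last first.
  by move=> a; apply: rhoP; exists a.
split=> [u /rd[v [[a ->] ua]]|u a a' -> [/emb_inj] //|R t t' tt' Lt].
  by exists a.
have [a [Aa ta]] := rr R t _ (fun i => erefl) Lt.
suff -> : t' = a by [].
apply: functional_extensionality => j; apply: emb_inj.
by have := tt' j; rewrite (f_equal (fun f => f j) ta) => -[].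
Qed.

Definition both (i : bool) (r : nat) (w : seq (U * U)) : Prop :=
  [/\ forall u x, pairs w u x -> dom (limit i) u /\ dom (limit (~~ i)) x,
      sim (limit i) (limit (~~ i)) r (pairs w)
    & sim (limit (~~ i)) (limit i) r (flip_rel (pairs w))].

Lemma position_stage i w x :
  (forall u x, pairs w u x -> dom (limit i) u /\ dom (limit (~~ i)) x) ->
  dom (limit (~~ i)) x ->
  exists n, (forall u x, pairs w u x -> dom (stage n i) u /\ dom (stage n (~~ i)) x) /\
    dom (stage n (~~ i)) x.
Proof.
move=> wd [n0 xn]; elim: w wd => [|[u y] w IH] wd; first by exists n0.
have [|n [wn xn']] := IH; first by move=> v z vz; apply: wd; right.
have [[n1 un1] [n2 yn2]] := wd u y (or_introl erefl).
exists (maxn n (maxn n1 n2)); split; last first.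
  by apply: stage_dom_le xn'; rewrite leq_maxl.
move=> v z [[<- <-]|/wn[vn zn]]; split.
- by apply: stage_dom_le un1; rewrite !leq_max leqnn !orbT.
- by apply: stage_dom_le yn2; rewrite !leq_max leqnn !orbT.
- by apply: stage_dom_le vn; rewrite leq_maxl.
by apply: stage_dom_le zn; rewrite leq_maxl.
Qed.

(** Stages are retracts of limits, so games can be moved between the two levels; the retraction acts
    on the target here and on the source in [sim_stage_limit]. *)
Lemma sim_limit_stage m n i j r p :
  (forall u x, p u x -> dom (stage m j) x) ->
  sim (limit i) (limit j) r p -> sim (stage n i) (stage m j) r p.
Proof.
move=> pd; have [rho [rhoh rhoP]] := limit_retract m j.
apply: (sim_map (stage_limit n i) rhoh) => u x ux.
by exists u, x; split=> //; rewrite /graph rhoP //; apply: pd ux.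
Qed.

Lemma sim_stage_limit m n i j r p :
  (forall u x, p u x -> dom (stage n i) u) ->
  sim (stage n i) (stage m j) r p -> sim (limit i) (limit j) r p.
Proof.
move=> pd; have [rho [rhoh rhoP]] := limit_retract n i.
apply: (sim_map rhoh (stage_limit m j)) => u x ux.
by exists u, x; split=> //; rewrite /graph rhoP //; apply: pd ux.
Qed.

(** A position is finite, so together with Spoiler's move it lives in some stage; the answer exists
    one stage later and stays good in the limit. *)
Lemma both_answer i r w x : both i r.+1 w -> dom (limit (~~ i)) x ->
  exists c, both i r ((c, x) :: w).
Proof.
move=> [wd s1 s2] xd; have [n [wn xn]] := position_stage wd xd.
have aw : admissible (stage n i) (stage n (~~ i)) r.+1 w.
  split=> //; first by apply: sim_limit_stage s1 => u y /wn[].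
  by apply: sim_limit_stage s2 => u y /wn[].
have [c [cd c1 c2]] :=
  attach_answer (@stage_fresh n i) (@stage_wf n i) aw xn.
exists c; split.
- move=> u y [[<- <-]|/wd //]; split=> //; by exists n.+1.
- apply: (sim_stage_limit (n := n.+1) (m := n)) c1 => u y [[<- _] //|/wn[un _]].
  by left.
by apply: (sim_stage_limit (n := n) (m := n.+1)) c2 => y u [[_ <-] //|/wn[]].
Qed.

Definition swap (w : seq (U * U)) := List.map (fun ux => (ux.2, ux.1)) w.

Lemma pairs_swap w : pairs (swap w) = flip_rel (pairs w).
Proof.
apply: functional_extensionality => x; apply: functional_extensionality => u.
apply: propositional_extensionality; rewrite /pairs /swap List.in_map_iff; split.
  by case=> -[u' x'] /= [[<- <-]].
by exists (u, x).
Qed.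

(** Since [both_answer] handles Spoiler's moves on one side only, moves on the other side are
    handled by exchanging the roles. *)
Lemma both_swap i r w : both i r w -> both (~~ i) r (swap w).
Proof.
case=> wd s1 s2; split; rewrite ?pairs_swap ?negbK //.
by move=> x u /wd[].
Qed.

Lemma limits_equivalent k (phi : sentence sigma) :
  sim (prestructure_of (A true)) (prestructure_of (A false)) k (@nowhere _ _) ->
  sim (prestructure_of (A false)) (prestructure_of (A true)) k (@nowhere _ _) ->
  qrank phi <= k ->
  models (structure_of (limit true)) phi <-> models (structure_of (limit false)) phi.
Proof.
move=> s1 s2 phik.
have start i j : sim (prestructure_of (A i)) (prestructure_of (A j)) k (@nowhere _ _) ->
    sim (limit i) (limit j) k (@nowhere _ _).
  have [f [fh _]] := limit_to_base i.
  exact: (sim_map fh (base_to_limit j)).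
(* Containment in a winning position suffices: functionality and preservation pass to
   subrelations. *)
pose Z r (p : structure_of (limit true) -> structure_of (limit false) -> Prop) :=
  exists w, (forall a b, p a b -> pairs w (sval a) (sval b)) /\ both true r w.
have sval_eq i (a b : structure_of (limit i)) : sval a = sval b -> a = b.
  by apply: eq_sig_hprop => x; apply: proof_irrelevance.
apply: (@back_and_forth _ _ _ Z _ _ _ _ phi k (@nowhere _ _)) => //.
- move=> r p [w [pw [_ w1 w2]]]; split.
  + move=> a b b' /pw ab /pw ab'; apply: sval_eq; exact: sim_functional w1 _ _ _ ab ab'.
  + move=> b a a' /pw ab /pw ab'; apply: sval_eq; exact: sim_functional w2 _ _ _ ab ab'.
  + by move=> R t t' tt'; apply: (sim_preserving w1) => i; apply/pw/tt'.
  by move=> R t t' tt'; apply: (sim_preserving w2) => i; apply/pw/tt'.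
- move=> r p [w [pw bw]] [a ad].
  have [c bc] := both_answer (both_swap bw) ad.
  have cd : dom (limit false) c by have [/(_ c a (or_introl erefl))[]] := bc.
  exists (exist _ c cd), (swap ((c, a) :: swap w)); split; last exact: both_swap bc.
  move=> x y; rewrite pairs_swap => -[[-> ->]|/pw xy]; first by left.
  by right; change (pairs (swap w) (sval y) (sval x)); rewrite pairs_swap.
- move=> r p [w [pw bw]] [b bd].
  have [c bc] := both_answer bw bd.
  have cd : dom (limit true) c by have [/(_ c b (or_introl erefl))[]] := bc.
  exists (exist _ c cd), ((c, b) :: w); split=> // x y.
  by case=> [[-> ->]|/pw xy]; [left|right].
- exists [::]; split=> //; split=> //.
    by apply: sim_sub (start _ _ s1).
  by apply: sim_sub (start _ _ s2).
by case.
Qed.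

Lemma limit_section i : exists s : A i -> structure_of (limit i), is_section s.
Proof.
have [f [[ftot ffun fhom] fK]] := limit_to_base i.
have in_limit (a : A i) : dom (limit i) (Base (emb a)) by exists 0, a.
exists (fun a : A i => exist _ (Base (emb a)) (in_limit a)); split.
  by move=> R t At; exists 0, t.
have /fun_choice[r rP] (u : structure_of (limit i)) : exists a, f (sval u) a.
  by case: u => u du; have [a [_ ua]] := ftot u du; exists a.
exists r; split; first by move=> R t; apply: fhom.
by move=> a; apply: ffun (rP (exist _ _ (in_limit a))) (fK a).
Qed.

End Companions.

Lemma companions sigma (A B : structure sigma) k :
  sim (prestructure_of A) (prestructure_of B) k (@nowhere _ _) ->
  sim (prestructure_of B) (prestructure_of A) k (@nowhere _ _) ->
  exists (A' B' : structure sigma) (s : A -> A') (s' : B -> B'),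
    [/\ is_section s, is_section s' &
      forall phi : sentence sigma, qrank phi <= k -> models A' phi <-> models B' phi].
Proof.
move=> sAB sBA.
pose F (i : bool) := if i then A else B.
pose emb i : F i -> A + B := match i with true => inl | false => inr end.
have emb_inj i : injective (emb i) by case: i => x y [].
have [s hs] := limit_section emb_inj true; have [s' hs'] := limit_section emb_inj false.
exists (structure_of (limit emb true)), (structure_of (limit emb false)), s, s'.
split=> // phi; exact: limits_equivalent.
Qed.

(** * The comonad and the existential game *)

Section Unravelling.
Variables (sigma : vocabulary) (A : structure sigma) (k : nat).
Notation play := (play A k).

Lemma class_eq (s t : play) :
  is_prefix s t -> last_move s = last_move t -> class_of_play s = class_of_play t.
Proof.
move=> st lst; apply: eq_sig_hprop => [C|/=]; first exact: proof_irrelevance.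
have ast : approx s t by apply: rst_step; split=> //; left.
apply: functional_extensionality => u; apply: propositional_extensionality.
by split; apply: rst_trans => //; apply: rst_sym.
Qed.

Lemma class_approx (s t : play) : class_of_play s = class_of_play t -> approx s t.
Proof. by move/(f_equal sval) => /= ->; apply: rst_refl. Qed.

Lemma repr_exists : exists rep : G A k -> play, forall c, class_of_play (rep c) = c.
Proof.
apply: (fun_choice (C := fun (c : G A k) s => class_of_play s = c)) => -[C [s Cs]].
exists s; apply: eq_sig_hprop => [D|/=]; [exact: proof_irrelevance | exact: esym].
Qed.

Lemma approx_invariant Y (f : play -> Y) :
  (forall s t, is_prefix s t -> last_move s = last_move t -> f s = f t) ->
  forall s t, approx s t -> f s = f t.
Proof.
move=> fP s t; elim=> {s t} [s t [[st|ts] lst]|s|s t _ ->|s t u _ -> _ ->] //.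
  exact: fP.
by apply/esym/fP.
Qed.

Lemma quotient_map Y (f : play -> Y) :
  (forall s t, is_prefix s t -> last_move s = last_move t -> f s = f t) ->
  exists g : G A k -> Y, forall s, g (class_of_play s) = f s.
Proof.
move=> /approx_invariant fP; have [rep repP] := repr_exists.
by exists (fun c => f (rep c)) => s; apply: fP; apply: class_approx; rewrite repP.
Qed.

Lemma counit_exists : exists e : G A k -> A,
  hom e /\ forall s, e (class_of_play s) = last_move s.
Proof.
have [e eP] := quotient_map (fun s t (_ : is_prefix s t) => id : _ -> last_move s = last_move t).
exists e; split=> // R c [s [sc _ As]].
have -> // : (fun i => e (c i)) = (fun i => last_move (s i)).
by apply: functional_extensionality => i; rewrite -sc eP.
Qed.

Lemma prefix_total (X : Type) (s1 s2 u1 u2 : seq X) : s1 ++ u1 = s2 ++ u2 ->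
  (exists u, s2 = s1 ++ u) \/ (exists u, s1 = s2 ++ u).
Proof.
elim: s1 s2 => [|x s1 IH] [|y s2] /=; try by
  [left; exists [::]|left; exists (y :: s2)|right; exists (x :: s1)].
by case=> -> /IH[[u ->]|[u ->]]; [left|right]; exists u.
Qed.

Lemma play_rcons (h : seq A) a : size h < k ->
  exists p : play, moves p = h ++ [:: a] /\ last_move p = a.
Proof.
case: h => [|x h] szh; first by exists (@Play _ A k a [::] szh).
have sz : size (h ++ [:: a]) < k by rewrite size_cat addn1.
by exists (@Play _ A k x (h ++ [:: a]) sz); rewrite /last_move /= last_cat.
Qed.

Definition along (h : seq A) : A -> G A k -> Prop := fun a c =>
  exists (p : play) u, [/\ h = moves p ++ u, last_move p = a & class_of_play p = c].

(** Prefixes of one history are comparable, so [approx] already identifies those with the same last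
    element. This is how the quotient makes answers respect equality. *)
Lemma along_functional h : functional (along h).
Proof.
move=> a c c' [p [u [hp pa <-]]] [p' [u' [hp' pa' <-]]].
case: (prefix_total (etrans (esym hp) hp')) => pp; last symmetry.
  by apply: class_eq; rewrite ?pa ?pa'.
by apply: class_eq; rewrite ?pa ?pa'.
Qed.

Lemma along_preserving h :
  preserving (prestructure_of A) (prestructure_of (G A k)) (along h).
Proof.
move=> R a c ac Aa; have /fun_choice[p pP] := ac; exists p; split.
- by move=> i; have [u []] := pP i.
- move=> i j; have [u [hi _ _]] := pP i; have [v [hj _ _]] := pP j.
  by case: (prefix_total (etrans (esym hi) hj)); [left|right].
suff -> : (fun i => last_move (p i)) = a by [].
by apply: functional_extensionality => i; have [u []] := pP i.
Qed.

(** Duplicator answers [a] by the class of the history extended by [a]; the size bound keeps this a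
    play. *)
Lemma sim_unravelling r h : size h + r <= k ->
  sim (prestructure_of A) (prestructure_of (G A k)) r (along h).
Proof.
elim: r h => [|r IH] h szh; split=> //; try exact: along_functional; try exact: along_preserving.
move=> a _; have [|p [mp pa]] := @play_rcons h a.
  by apply: leq_trans szh; rewrite addnS ltnS leq_addr.
exists (class_of_play p); split=> //.
apply: sim_sub (IH (h ++ [:: a]) _); last by rewrite size_cat addn1 addSnnS.
move=> x c [[-> ->]|[q [u [-> qx qc]]]]; first by exists p, [::]; rewrite cats0.
by exists q, (u ++ [:: a]); rewrite catA.
Qed.

Lemma prefix_size (s t : play) :
  comparable_plays s t -> size (moves s) <= size (moves t) -> is_prefix s t.
Proof.
case=> // -[u E]; rewrite E size_cat -[leqRHS]addn0 leq_add2l leqn0 => /nilP u0.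
by exists [::]; rewrite E u0 !cats0.
Qed.

(** The longest play extends all the others. The left alternative covers nullary relations, where
    there is no play to choose. *)
Lemma common_extension n (s : 'I_n -> play) :
  (forall i j, comparable_plays (s i) (s j)) ->
  ('I_n -> False) \/ exists t, forall i, is_prefix (s i) t.
Proof.
case: n s => [|n] s sP; [by left=> -[] | right].
case: (@arg_maxnP _ ord0 xpredT (fun i => size (moves (s i))) isT) => i _ imax.
by exists (s i) => j; apply: prefix_size => //; apply: imax.
Qed.

(** A class is sent to Duplicator's answer to the last move of any representative, under a fixed
    strategy. Related classes have representatives along one play, hence in one position. *)
Lemma hom_of_sim (B : structure sigma) :
  0 < k -> sim (prestructure_of A) (prestructure_of B) k (@nowhere _ _) ->
  exists f : G A k -> B, hom f.
Proof.
(* The strategy needs a default point of [B]. If [B] is empty, Duplicator could not answer a first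
   move, so there are no plays and only nullary relations remain. *)
move=> k0 sAB; case: (classic (inhabited B)) => [[d]|nB]; last first.
  have nA (p : play) : False.
    by case: k k0 sAB => // k' _ [_ _ /(_ (play_head p) I)[b _]]; apply: nB.
  have [rep _] := repr_exists.
  exists (fun c => False_rect _ (nA (rep c))) => R t [s [_ _ As]].
  apply: (sim_preserving sAB) As => i.
  by case: (nA (rep (t i))).
have [g gP] := strategy d sAB.
have szk (s : play) : size (rev (moves s)) <= k by case: s => x h sz; rewrite size_rev.
have adom s : all_dom (prestructure_of A) s by [].
have gs (s t : play) : is_prefix s t ->
    play_out g (@nowhere _ _) (rev (moves t)) (last_move s) (g (rev (moves s))).
  case=> u ->; rewrite rev_cat; apply: play_out_cat.
  by rewrite /moves lastI rev_rcons; left.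
(* In the position after [t] both values answer the same element, and positions are functional. *)
have fP (s t : play) : is_prefix s t -> last_move s = last_move t ->
    g (rev (moves s)) = g (rev (moves t)).
  move=> st lst; have [sg _] := gP _ (szk t) (adom _).
  apply: (sim_functional sg (gs _ _ st)); rewrite lst; apply: gs.
  by exists [::]; rewrite cats0.
have [f fE] := quotient_map fP.
exists f => R c [s [sc ss As]].
have -> : (fun i => f (c i)) = (fun i => g (rev (moves (s i)))).
  by apply: functional_extensionality => i; rewrite -sc fE.
case: (common_extension ss) => [R0|[t tP]].
  by apply: (sim_preserving sAB) As => i; case: (R0 i).
have [sg _] := gP _ (szk t) (adom _).
by apply: (sim_preserving sg) As => i; apply: gs.
Qed.

End Unravelling.

(** * Formulas deciding the game *)

Section Bases.
Variable sigma : vocabulary.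
Implicit Types (A B : structure sigma) (S : seq (symbol sigma)).

(** Plays the part of the reduct to [S], but keeps the vocabulary, so that membership in [D] and the
    same formulas still make sense. *)
Definition restrict S A : structure sigma :=
  @Structure sigma A (fun R t => List.In R S /\ interp A R t).

Fixpoint symbols n (f : formula sigma n) : seq (symbol sigma) :=
  match f with
  | FTrue _ | FFalse _ | FEq _ _ _ => [::]
  | FRel _ R _ => [:: R]
  | FNot _ f | FEx _ f | FAll _ f => symbols f
  | FAnd _ f g | FOr _ f g => List.app (symbols f) (symbols g)
  end.

Lemma holds_restrict S A n (f : formula sigma n) (e : 'I_n -> A) :
  (forall R, List.In R (symbols f) -> List.In R S) ->
  @holds sigma (restrict S A) n f e <-> holds f e.
Proof.
elim: f e => {n} [n|n|n i j|n R v|n f IH|n f IHf g IHg|n f IHf g IHg|n f IH|n f IH] e /= fS //.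
- by split=> [[]|h] //; split=> //; apply: fS; left.
- by rewrite IH.
- by rewrite IHf ?IHg // => R fR; apply/fS/List.in_or_app; [right|left].
- by rewrite IHf ?IHg // => R fR; apply/fS/List.in_or_app; [right|left].
- by split=> -[a ha]; exists a; apply/IH.
by split=> h a; apply/IH.
Qed.

Definition conj n (L : seq (formula sigma n)) : formula sigma n := foldr (@FAnd _ n) FTrue L.

Lemma holds_conj A n (L : seq (formula sigma n)) (e : 'I_n -> A) :
  holds (conj L) e <-> forall f, List.In f L -> holds f e.
Proof.
elim: L => [|f L IH] /=; first by split.
rewrite IH; split=> [[hf hL] g [<-|/hL]|h] //.
by split=> [|g gL]; apply: h; [left|right].
Qed.

Definition positive_upto n r (f : formula sigma n) : Prop :=
  existential_positive f /\ qrank f <= r.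

Lemma conj_positive n r (L : seq (formula sigma n)) :
  (forall f, List.In f L -> positive_upto r f) -> positive_upto r (conj L).
Proof.
elim: L => [|f L IH] //= fL.
have [|cL rL] := IH; first by move=> g gL; apply: fL; right.
have [cf rf] := fL f (or_introl erefl).
by split=> /=; rewrite ?cf ?cL // geq_max rf rL.
Qed.

Fixpoint sublists (Y : Type) (L : seq Y) : seq (seq Y) :=
  if L is x :: L' then List.app (sublists L') (List.map (cons x) (sublists L'))
  else [:: [::]].

Lemma sublists_incl Y (L L' : seq Y) x :
  List.In L' (sublists L) -> List.In x L' -> List.In x L.
Proof.
elim: L L' => [|y L IH] L' /=; first by case=> // <-.
rewrite List.in_app_iff List.in_map_iff => -[/IH h /h|[L2 [<- /IH h]] /= [->|/h]]; by [left|right].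
Qed.

Lemma sublists_filter Y (p : Y -> Prop) (L : seq Y) :
  exists L', List.In L' (sublists L) /\ forall x, List.In x L' <-> List.In x L /\ p x.
Proof.
elim: L => [|y L [L' [L'L L'P]]] /=; first by exists [::]; split=> [|x]; [left|split=> [|[]]].
case: (classic (p y)) => py.
  exists (y :: L'); rewrite List.in_app_iff List.in_map_iff; split.
    by right; exists L'.
  move=> x /=; rewrite L'P; split=> [[<-|[]]|[[]]]; by auto.
exists L'; rewrite List.in_app_iff; split; first by left.
by move=> x; rewrite L'P; split=> [[]|[[<-|]]]; auto.
Qed.

Lemma in_list (Y : eqType) (s : seq Y) x : x \in s -> List.In x s.
Proof. by elim: s => //= y s IH; rewrite inE => /orP[/eqP->|/IH]; [left|right]. Qed.

Definition atoms S n : seq (formula sigma n) :=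
  List.app
    (List.flat_map (fun i => List.map (FEq i) (enum 'I_n)) (enum 'I_n))
    (List.flat_map (fun R => List.map (FRel R) (enum {ffun 'I_(arity R) -> 'I_n})) S).

(* A finite set of formulas deciding the [r]-round existential game. *)
Fixpoint basis S r n : seq (formula sigma n) :=
  List.app (atoms S n)
    (if r is r'.+1 then List.map (fun L => FEx (conj L)) (sublists (basis S r' n.+1))
     else [::]).

Lemma atoms_basis S r n f : List.In f (atoms S n) -> List.In f (basis S r n).
Proof. by case: r => [|r] fS; apply/List.in_app_iff; left. Qed.

Lemma atoms_eq S n (i j : 'I_n) : List.In (FEq i j) (atoms S n).
Proof.
apply/List.in_app_iff; left; apply/List.in_flat_map; exists i.
by split; [|apply: List.in_map]; apply: in_list; rewrite mem_enum.
Qed.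

Lemma atoms_rel S n R (v : {ffun 'I_(arity R) -> 'I_n}) :
  List.In R S -> List.In (FRel R v) (atoms S n).
Proof.
move=> RS; apply/List.in_app_iff; right; apply/List.in_flat_map; exists R.
by split=> //; apply: List.in_map; apply: in_list; rewrite mem_enum.
Qed.

Lemma atoms_positive S n r f : List.In f (atoms S n) -> positive_upto r f.
Proof.
rewrite List.in_app_iff => -[]/List.in_flat_map[i [_ /List.in_map_iff[j [<- _]]]] //.
Qed.

Lemma basis_positive S r n f : List.In f (basis S r n) -> positive_upto r f.
Proof.
elim: r n f => [|r IH] n f /List.in_app_iff[/atoms_positive //|] //.
move=> /List.in_map_iff[L [<- LS]].
by apply: (@conj_positive n.+1 r) => g gL; apply: IH; apply: sublists_incl LS gL.
Qed.

Lemma sim0_of_atoms S r n A B (e : 'I_n -> A) (e' : 'I_n -> B) :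
  (forall f, List.In f (basis S r n) -> holds f e -> holds f e') ->
  functional (fun a b => exists i, e i = a /\ e' i = b) /\
  preserving (prestructure_of (restrict S A)) (prestructure_of B)
    (fun a b => exists i, e i = a /\ e' i = b).
Proof.
move=> ee'; split=> [a b b' [i [<- <-]] [j [ij <-]]|R t t' tt' [RS At]].
  by apply: (ee' (FEq i j)) => //; apply/atoms_basis/atoms_eq.
have /fun_choice[v vP] := tt'.
have -> : t' = (fun i => e' ([ffun i => v i] i)).
  by apply: functional_extensionality => i; rewrite ffunE; case: (vP i).
apply: (ee' (FRel R [ffun i => v i])); first exact/atoms_basis/atoms_rel.
rewrite /=; suff <- : t = (fun i => e ([ffun i => v i] i)) by [].
by apply: functional_extensionality => i; rewrite ffunE; case: (vP i).
Qed.

(** The basis formulas of the next lower rank true of Spoiler's move form a finite positive type.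
    That some element satisfies them all is again a basis formula; its truth on the other side
    yields the answer. *)
Lemma sim_of_basis S r n A B (e : 'I_n -> A) (e' : 'I_n -> B) :
  (forall f, List.In f (basis S r n) -> holds f e -> holds f e') ->
  sim (prestructure_of (restrict S A)) (prestructure_of B) r
    (fun a b => exists i, e i = a /\ e' i = b).
Proof.
elim: r n e e' => [|r IH] n e e' ee'; have [? ?] := sim0_of_atoms ee'; split=> //.
move=> a _.
have [L [LK LP]] := sublists_filter (fun f => @holds _ A _ f (extend a e)) (basis S r n.+1).
have exL : List.In (FEx (conj L)) (basis S r.+1 n).
  by apply/List.in_app_iff; right; apply: (List.in_map (fun L => FEx (conj L))).
have [b hb] : exists b, holds (conj L) (extend b e').
  by apply: (ee' _ exL); exists a; apply/holds_conj => f /LP[].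
exists b; split=> //; apply: sim_sub (IH n.+1 (extend a e) (extend b e') _).
  move=> x y [[-> ->]|[i [<- <-]]].
    by exists ord0; rewrite /extend unlift_none.
  by exists (lift ord0 i); rewrite /extend liftK.
by move=> f fK fa; move/holds_conj: hb; apply; apply/LP.
Qed.

Lemma existential_positive_hom A B (f : A -> B) n (phi : formula sigma n) e :
  hom f -> existential_positive phi -> holds phi e -> holds phi (fun i => f (e i)).
Proof.
move=> hf; elim: phi e => {n} [n|n|n i j|n R v|n g IH|n g IHg h IHh|n g IHg h IHh|n g IH|n g IH] e //=.
- by move=> _ ->.
- by move=> _; apply: hf.
- by move=> /andP[gp hp] [/IHg-/(_ gp) ? /IHh-/(_ hp) ?].
- by move=> /andP[gp hp] [/IHg-/(_ gp) ?|/IHh-/(_ hp) ?]; [left|right].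
move=> gp [a ga]; exists (f a).
have -> : extend (f a) (fun i => f (e i)) = (fun i => f (extend a e i)).
  by apply: functional_extensionality => i; rewrite /extend; case: unlift.
exact: IH.
Qed.

End Bases.

Lemma no_vars_eq X (e : 'I_0 -> X) : e = @no_vars X.
Proof. by apply: functional_extensionality => -[]. Qed.

(** * The preservation theorem and negative theories *)

Section Core.
Variables (sigma : vocabulary) (D : structure sigma -> Prop).
Hypothesis D_coretract : co_retract_closed D.
Hypothesis D_G : forall (A : structure sigma) (k : nat), 0 < k -> D A -> D (G A k).

(** Duplicator may win only from [A] to [B], so [companions] cannot be applied to this pair. It
    applies to [A] and [G A k], where the counit wins one direction and the unravelling the
    other. *)
Lemma preserved_sim k phi (A B : structure sigma) :
  0 < k -> qrank phi <= k -> hom_preserved D phi -> D A -> D B ->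
  sim (prestructure_of A) (prestructure_of B) k (@nowhere _ _) ->
  models A phi -> models B phi.
Proof.
move=> k0 phik pres DA DB sAB phiA.
have [eps [eps_hom _]] := counit_exists A k.
have sAG : sim (prestructure_of A) (prestructure_of (G A k)) k (@nowhere _ _).
  exact: sim_sub (@sim_unravelling _ A k k [::] (leqnn _)).
have sGA : sim (prestructure_of (G A k)) (prestructure_of A) k (@nowhere _ _).
  have eps_phom : phom (prestructure_of (G A k)) (prestructure_of A) (graph eps).
    exact: phom_graph.
  by apply: (@sim_hom _ _ _ _ _ _ k (@nowhere _ _) eps_phom).
have [A' [C' [s [s' [sec sec' equiv]]]]] := companions sAG sGA.
have DC := D_G k0 DA.
have DA' := D_coretract sec DA; have DC' := D_coretract sec' DC.
have [f f_hom] := hom_of_sim k0 sAB.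
have [s_hom _] := sec; have [_ [r [r_hom _]]] := sec'.
apply: (pres _ _ f DC DB f_hom); apply: (pres _ _ r DC' DC r_hom).
by apply/equiv => //; apply: (pres _ _ s DA DA' s_hom).
Qed.

Lemma equirank_restrict k phi S :
  (forall R, List.In R (symbols phi) -> List.In R S) ->
  (forall A, D A -> D (restrict S A)) ->
  0 < k -> qrank phi <= k ->
  (hom_preserved D phi <->
   exists psi : sentence sigma,
     [/\ existential_positive psi, qrank psi <= k
       & forall A : structure sigma, D A -> (models A phi <-> models A psi)]).
Proof.
move=> phiS DS k0 phik; split; last first.
  case=> psi [psip _ psiP] A B f DA DB hf /(psiP A DA) Apsi; apply/(psiP B DB).
  rewrite /models -(no_vars_eq (fun i => f (@no_vars A i))).
  exact: existential_positive_hom hf psip Apsi.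
move=> pres.
(* One inclusion is enough: [conj L] then implies every basis formula true in that model of
   [phi]. *)
pose realised (L : seq (formula sigma 0)) := exists A, [/\ D A, models A phi &
  forall f, List.In f (basis S k 0) -> holds f (@no_vars A) -> List.In f L].
(* There are finitely many [L]; excluded middle keeps the realised ones, and [psi] is the
   disjunction of their conjunctions. *)
have [psi [psip psik psiP]] : exists psi : sentence sigma,
    [/\ existential_positive psi, qrank psi <= k & forall A : structure sigma,
      models A psi <-> exists L, [/\ List.In L (sublists (basis S k 0)), realised L
        & models A (conj L)]].
  have : forall L, List.In L (sublists (basis S k 0)) -> positive_upto k (conj L).
    move=> L LK; apply: conj_positive => f fL.
    by apply: basis_positive; apply: sublists_incl LK fL.
  elim: (sublists _) => [|L Ls IH] LsP.
    by exists FFalse; split=> // A; split=> // -[L []].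
  have [|psi [psip psik psiP]] := IH; first by move=> L' L'P; apply: LsP; right.
  have [cp ck] := LsP L (or_introl erefl).
  case: (classic (realised L)) => rL.
    exists (FOr (conj L) psi); split; first exact/andP.
      by rewrite /= geq_max ck psik.
    move=> A; rewrite /models /= -/(models A psi) psiP; split.
      by case=> [cL|[L' [L'P rL' cL']]]; [exists L|exists L']; split=> //; [left|right].
    by case=> L' [[<-|L'P] rL' cL']; [left|right; exists L'].
  exists psi; split=> // A; rewrite psiP; split=> -[L' [L'P rL' cL']]; exists L'.
    by split=> //; right.
  by split=> //; case: L'P => // LL'; case: rL; rewrite LL'.
exists psi; split=> // A DA; rewrite psiP; split.
  move=> Aphi; have [L [LK LP]] := sublists_filter (fun f => holds f (@no_vars A)) (basis S k 0).
  exists L; split=> //; last by apply/holds_conj => f /LP[].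
  by exists A; split=> // f fK fA; apply/LP.
case=> L [LK [B [DB Bphi BL]] /holds_conj AL].
(* The basis does not control symbols outside [S], so the game starts from the restriction of [B],
   which still lies in [D] and satisfies [phi]. *)
have BA : sim (prestructure_of (restrict S B)) (prestructure_of A) k (@nowhere _ _).
  have := @sim_of_basis _ S k 0 B A (@no_vars B) (@no_vars A).
  by move/(_ (fun f fK fB => AL f (BL f fK fB))); apply: sim_sub.
apply: (preserved_sim k0 phik pres (DS _ DB) DA BA).
exact/(@holds_restrict _ S B).
Qed.

End Core.

(** Homomorphisms reflect negated atoms. Existential witnesses are lifted by [g], which need not be
    a homomorphism, and universal instances are taken at images under [r]. *)
Lemma negative_pullback sigma (A B : structure sigma) (r : B -> A) (g : A -> B) n
    (f : formula sigma n) (e : 'I_n -> B) :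
  hom r -> cancel g r -> negative f -> holds f (fun i => r (e i)) -> holds f e.
Proof.
move=> rh gK; elim: f e => {n} [n|n|n i j|n R v|n f _|n f IHf h IHh|n f IHf h IHh|n f IH|n f IH] e //=.
- by case: f e => //= {n} [n i j|n R v] e _ nh; [move=> E; apply: nh; rewrite E | move/rh].
- by move=> /andP[fn hn] [/IHf-/(_ fn) ? /IHh-/(_ hn) ?].
- by move=> /andP[fn hn] [/IHf-/(_ fn) ?|/IHh-/(_ hn) ?]; [left|right].
- move=> fn [a fa]; exists (g a); apply: IH => //.
  suff <- : extend a (fun i => r (e i)) = (fun i => r (extend (g a) e i)) by [].
  by apply: functional_extensionality => i; rewrite /extend; case: unlift.
move=> fn fa b; apply: IH => //.
suff <- : extend (r b) (fun i => r (e i)) = (fun i => r (extend b e i)) by apply: fa.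
by apply: functional_extensionality => i; rewrite /extend; case: unlift.
Qed.

Lemma Mod_pullback sigma (T : sentence sigma -> Prop) (A B : structure sigma)
    (r : B -> A) (g : A -> B) :
  (forall phi, T phi -> negative phi) -> hom r -> cancel g r -> Mod T A -> Mod T B.
Proof.
move=> Tn rh gK TA phi Tphi; apply: (negative_pullback rh gK (Tn _ Tphi)).
by rewrite (no_vars_eq (fun i => r (@no_vars B i))); apply: TA.
Qed.

Theorem theorem5p12 (sigma : vocabulary) :
  (forall D : structure sigma -> Prop,
     finite_vocabulary sigma ->
     co_retract_closed D ->
     (forall (A : structure sigma) (k : nat), 0 < k -> D A -> D (G A k)) ->
     equirank_HPT D) /\
  (forall T : sentence sigma -> Prop,
     (forall phi, T phi -> negative phi) ->
     equirank_HPT (Mod T)).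
Proof.
split=> [D [S fullS] Dcr DG|T Tn] k phi.
  apply: (@equirank_restrict sigma D Dcr DG k phi S) => // A.
  (* Here [S] lists every symbol, so the identity is an isomorphism. *)
  apply: (Dcr _ _ (id : A -> restrict S A)); split=> //.
  by exists id; split=> // R t [].
(* Only the symbols of [phi] are kept, so the vocabulary may be infinite. *)
apply: (@equirank_restrict sigma (Mod T) _ _ k phi (symbols phi)) => //.
- move=> A B s [sh [r [rh sK]]]; exact: Mod_pullback rh sK.
- move=> A [//|k'] k0; have [e [eh eE]] := counit_exists A k'.+1.
  (* Plays of length one, available as [k] is positive, split the counit as a mere function. *)
  have eK : cancel (fun a => class_of_play (@Play _ A k'.+1 a [::] k0)) e.
    by move=> a; rewrite eE.
  exact: (Mod_pullback Tn eh eK).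
move=> A; apply: (Mod_pullback Tn (r := id : restrict _ A -> A) (g := id)) => // R t.
by case.
Qed.
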